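(* Let $k(t,s)=\sum_{i=0}^\infty\sum_{j=0}^\infty t^is^jK_{ij}$ (with $K_{ij}$ real $N\times N$ matrices), $\xi(t)=\sum_{i=0}^\infty t^i\Xi_i$ and $x(t)=\sum_{i=0}^\infty t^iX_i$ (with $\Xi_i,X_i\in\mathbb{R}^N$) be power series that converge absolutely for $|t|,|s|<\rho$ for some $\rho>0$. If $x$ satisfies the linear Volterra system $$x(t)=\xi(t)+\int_0^tk(t,s)x(s)\,ds$$ for all sufficiently small $t\ge0$, then the coefficients of $x$ satisfy, for all $n\ge0$, $$X_n=\Xi_n+\sum_{l=0}^{n-1}\sum_{i=0}^{n-l-1}\frac{1}{n-i}\,K_{i,n-i-l-1}\,X_l .$$
   Context: Sums over empty index sets are $0$ (so the case $n=0$ reads $X_0=\Xi_0$). *)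

(* Defs.v *)
From HB Require Import structures.
From mathcomp Require Import all_boot all_order all_algebra.
From mathcomp Require Import all_classical all_reals all_analysis.
Set Implicit Arguments.
Unset Strict Implicit.
Unset Printing Implicit Defensive.
Import Order.TTheory GRing.Theory Num.Theory.
Import numFieldNormedType.Exports.
Local Open Scope classical_set_scope.
Local Open Scope ring_scope.

(* Power series with matrix coefficients (the library's pseries is scalar).
   Matrices carry the max norm, so limits of matrices are entrywise. *)

Definition mx_pseries (R : realType) (m n : nat)
    (a : nat -> 'M[R]_(m, n)) (t : R) : 'M[R]_(m, n) :=
  limn [series t ^+ i *: a i]_i.

Definition mx_pseries_abs_cvg (R : realType) (m n : nat)
    (a : nat -> 'M[R]_(m, n)) (t : R) : Prop :=
  cvgn [normed [series t ^+ i *: a i]_i].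

Definition mx_pseries2 (R : realType) (m n : nat)
    (a : nat -> nat -> 'M[R]_(m, n)) (t s : R) : 'M[R]_(m, n) :=
  limn [series limn [series (t ^+ i * s ^+ j) *: a i j]_j]_i.

(* Absolute convergence of the double series: the norms of its terms are
   summable over all pairs (i, j), independently of the order. *)
Definition mx_pseries2_abs_cvg (R : realType) (m n : nat)
    (a : nat -> nat -> 'M[R]_(m, n)) (t s : R) : Prop :=
  summable [set: nat * nat]
    (fun ij => `|(t ^+ ij.1 * s ^+ ij.2) *: a ij.1 ij.2|%:E).

(* Entrywise integral over [a, b]; it is 0, not minus the integral over [b, a],
   when b < a. *)
Definition mx_integral (R : realType) (m n : nat)
    (a b : R) (f : R -> 'M[R]_(m, n)) : 'M[R]_(m, n) :=
  \matrix_(p, q) \int[@lebesgue_measure R]_(s in `[a, b]) f s p q.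

(* Main.v *)
(* All coefficients are O(c^i) for some c, so replacing the three series by their
   partial sums of order n costs O(t^n) uniformly in 0 <= s <= t <= 1 / (2 c).
   Integrating the truncated kernel term exactly, the Volterra equation says that
   an explicit polynomial in t is O(t^n) as t -> 0+, so its coefficients of degree
   below n vanish; with n = m + 1, the one of degree m is the recursion for X_m. *)

Require Import Defs.
From HB Require Import structures.
From mathcomp Require Import all_boot all_order all_algebra.
From mathcomp Require Import all_classical all_reals all_analysis.
From mathcomp Require Import measurable_realfun zify ring lra.
Import Order.TTheory GRing.Theory Num.Theory.
Import numFieldNormedType.Exports.
Local Open Scope classical_set_scope.
Local Open Scope ring_scope.

(** * Limits, geometric tails, polynomials near 0 and an integral estimate *)

Lemma cvg_mx_entrywise (R : realType) (m n : nat) (A : nat -> 'M[R]_(m, n))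
    (B : 'M[R]_(m, n)) :
  (forall p q, (fun i => A i p q) @ \oo --> B p q) -> A @ \oo --> B.
Proof.
move=> h; apply/cvg_ballP => e e0.
have H : \forall i \near \oo, forall p, forall q, ball (B p q) e (A i p q).
  apply: filter_forall => p; apply: filter_forall => q.
  by have /cvg_ballP/(_ e e0) := h p q.
by apply: filterS H => i Hi; split.
Qed.

Lemma ler_entry_mx_norm (R : realType) (m n : nat) (A : 'M[R]_(m, n)) p q :
  `|A p q| <= `|A|.
Proof.
rewrite [leRHS]/Num.norm /= mx_normrE; apply/bigmax_geP; right.
by exists (p, q).
Qed.

(** Domination by a geometric series; the factor 2 bounds [1 / (1 - q)] for [q <= 1/2]. An explicit
    constant is what makes the remainders below uniform in [s]. *)
Lemma cvg_series_geometric_tail (R : realType) (u : nat -> R) (M q : R) :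
  0 <= q -> q <= 2^-1 -> (forall i, `|u i| <= M * q ^+ i) ->
  cvgn (series u) /\
  forall n, `|limn (series u) - series u n| <= 2 * M * q ^+ n.
Proof.
move=> q0 q2 hu.
have M0 : 0 <= M by have := hu 0%N; rewrite expr0 mulr1; apply: le_trans.
have tail n m : (n <= m)%N -> `|series u m - series u n| <= 2 * M * q ^+ n.
  move=> nm; rewrite sub_series nm; apply: le_trans (ler_norm_sum _ _ _) _.
  have -> : 2 * M * q ^+ n = M * q ^+ n * 2 by ring.
  rewrite -(subnKC nm); set d := (m - n)%N.
  (* The bound is sharpened by the term [q ^+ d * 2] so that induction on [d] closes: the step needs
     only [2 * q ^+ d.+1 <= q ^+ d]. *)
  apply: (@le_trans _ _ (M * q ^+ n * (2 - q ^+ d * 2))); last first.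
    apply: ler_wpM2l; first by rewrite mulr_ge0 // exprn_ge0.
    by have := exprn_ge0 d q0; lra.
  elim: d => [|d IH]; first by rewrite addn0 big_geq // expr0; nra.
  rewrite addnS big_nat_recr /= ?leq_addr //.
  have := hu (n + d)%N; rewrite exprD exprS => hd.
  have h1 : 0 <= M * q ^+ n * q ^+ d by rewrite !mulr_ge0 // exprn_ge0.
  apply: le_trans (lerD IH hd) _.
  have : M * q ^+ n * q ^+ d * q <= M * q ^+ n * q ^+ d * 2^-1 by apply: ler_wpM2l.
  by lra.
have cu : cvgn (series u).
  apply: normed_cvg => //=.
  apply: (@series_le_cvg _ _ (geometric M q)) => //.
  - by move=> n /=.
  - by move=> n /=; rewrite mulr_ge0 // exprn_ge0.
  - by apply: is_cvg_geometric_series; rewrite ger0_norm //; lra.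
split=> // n.
have c2 : (fun m => `|series u m - series u n|) @ \oo --> `|limn (series u) - series u n|.
  by apply: cvg_norm; apply: cvgB => //; apply: cvg_cst.
rewrite -(cvg_lim _ c2) //; apply: limr_le; first by apply/cvg_ex; eexists; exact: c2.
by exists n => // m /= nm; apply: tail.
Qed.

(** Letting [t] tend to 0 from the right gives [p.[0] = 0], so [p = q * 'X]; dividing the bound by
    [t] gives the same bound for [q] with exponent one lower. Only positive [t] are used, because
    the Volterra equation is known on one side of 0 only. *)
Lemma poly_coef_eq0_near0 (R : realType) (n : nat) (p : {poly R}) (C d : R) :
  0 < d -> (forall t, 0 < t -> t < d -> `|p.[t]| <= C * t ^+ n) ->
  forall m, (m < n)%N -> p`_m = 0.
Proof.
move=> d0; elim: n p => // n IH p hp.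
have p0 : p.[0] = 0.
  apply/eqP; rewrite -normr_le0.
  have c1 : `|p.[t]| @[t --> 0^'+] --> `|p.[0]|.
    apply: cvg_norm; apply: cvg_at_right_filter; exact: continuous_horner.
  have c2 : C * t ^+ n.+1 @[t --> 0^'+] --> C * 0 ^+ n.+1.
    apply: cvg_at_right_filter; apply: cvgM; first exact: cvg_cst.
    exact: exprn_continuous.
  rewrite expr0n mulr0 in c2.
  apply: ler_cvg_to c1 c2 _.
  near=> t; apply: hp; first by near: t; exact: nbhs_right_gt.
  by near: t; exact: nbhs_right_lt.
have [q pE] : exists q, p = q * 'X.
  have /factor_theorem[q ->] : root p 0 by apply/rootP.
  by exists q; rewrite subr0.
case=> [|m] mn; first by rewrite pE coefMX.
rewrite pE coefMX /=; apply: IH => // t t0 td.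
have := hp t t0 td; rewrite pE hornerMX normrM (gtr0_norm t0) exprSr mulrA.
by rewrite ler_pM2r.
Unshelve. all: by end_near. Qed.

Lemma Rintegral_deriv_poly_approx (R : realType) (f : R -> R) (F : {poly R}) (t E : R) :
  0 <= t -> measurable_fun `[0, t] f ->
  (forall s, 0 <= s -> s <= t -> `|f s - F^`().[s]| <= E) ->
  `|\int[@lebesgue_measure R]_(s in `[0, t]) f s - (F.[t] - F.[0])| <= E * t.
Proof.
(* The case [t = 0] is separate: the fundamental theorem is applied on a nondegenerate interval. *)
rewrite le_eqVlt => /orP[/eqP <- _ _|t0 mf hf].
  by rewrite set_itv1 Rintegral_set1 !subrr normr0 mulr0.
have cP : {within `[0, t], continuous (horner F^`())}.
  by apply: continuous_subspaceT; exact: continuous_horner.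
have cpt : compact (`[0, t] : set R) by exact: segment_compact.
have iP : (@lebesgue_measure R).-integrable `[0, t] (EFin \o horner F^`()).
  exact: continuous_compact_integrable.
have mP : measurable_fun (`[0, t] : set R) (horner F^`()).
  by apply: measurable_funTS; apply: continuous_measurable_fun; exact: continuous_horner.
have finm : (@lebesgue_measure R `[0%R, t] < +oo)%E by exact: compact_finite_measure.
(* Integrability of [f] is not assumed: the difference is measurable and bounded on a set of finite
   measure, and adding back the polynomial gives [f]. *)
have id : (@lebesgue_measure R).-integrable `[0, t] (EFin \o (fun s => f s - F^`().[s])).
  apply: measurable_bounded_integrable => //; first exact: measurable_funB.
  exists E; split; first exact: num_real.
  move=> M EM s /=; rewrite in_itv /= => /andP[s0 st].
  exact: le_trans (hf s s0 st) (ltW EM).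
have intP : \int[@lebesgue_measure R]_(s in `[0, t]) F^`().[s] = F.[t] - F.[0].
  rewrite /Rintegral (@continuous_FTC2 _ _ (horner F)) //.
  - split.
    + by move=> x _; exact: derivable_horner.
    + by apply: cvg_at_right_filter; exact: continuous_horner.
    + by apply: cvg_at_left_filter; exact: continuous_horner.
  - by move=> x _; rewrite derivE.
have iF : (@lebesgue_measure R).-integrable `[0, t] (EFin \o f).
  have -> : EFin \o f = (fun s => ((f s - F^`().[s]) + F^`().[s])%:E).
    by apply/funext => s /=; rewrite subrK.
  by apply: integrableD id iP.
rewrite -intP -RintegralB //.
apply: le_trans (le_normr_Rintegral _ id) _ => //.
have -> : E * t = \int[@lebesgue_measure R]_(s in `[0, t]) E.
  rewrite Rintegral_cst //; congr (_ * _).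
  have h : fine (lebesgue_measure ([set` `[0, t]] : set R)) = t.
    by rewrite lebesgue_measure_itv /= lte_fin t0 /= subr0.
  exact: esym h.
apply: le_Rintegral => //.
- exact: integrable_norm.
- by apply: continuous_compact_integrable => //; apply: continuous_subspaceT; exact: cst_continuous.
- by move=> s /=; rewrite in_itv /= => /andP[s0 st]; exact: hf.
Qed.

(** * Coefficient bounds and Taylor remainders of single series *)

Lemma limn_series_mx_entry (R : realType) (m n : nat) (u : nat -> 'M[R]_(m, n)) :
  (forall p q, cvgn (series (fun i => u i p q))) ->
  forall p q, limn (series u) p q = limn (series (fun i => u i p q)).
Proof.
move=> cu p q.
have -> : limn (series u) = \matrix_(p, q) limn (series (fun i => u i p q)).
  apply: cvg_lim => //; apply: cvg_mx_entrywise => p' q'; rewrite mxE.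
  have -> : (fun i => series u i p' q') = series (fun i => u i p' q').
    by apply/funext => i; rewrite /series /= summxE.
  exact: cu.
by rewrite mxE.
Qed.

(** The terms of a convergent series tend to 0, hence are bounded; dividing by [r ^+ i] bounds the
    coefficients. *)
Lemma mx_pseries_coef_bound (R : realType) (m n : nat) (a : nat -> 'M[R]_(m, n)) (r : R) :
  0 < r -> mx_pseries_abs_cvg a r ->
  exists M, forall i p q, `|a i p q| <= M * r^-1 ^+ i.
Proof.
move=> r0 /cvg_series_cvg_0 /cvgP /cvg_seq_bounded [M [_ hM]].
(* Boundedness is phrased with every number strictly above [M], hence the witness [M + 1]. *)
exists (M + 1) => i p q.
have MM : M < M + 1 by rewrite ltrDl.
have := hM (M + 1) MM i I => /=.
rewrite normr_id normrZ normrX (gtr0_norm r0) => h.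
rewrite exprVn ler_pdivlMr ?exprn_gt0 // mulrC.
by apply: le_trans h; rewrite ler_pM2l ?exprn_gt0 // ler_entry_mx_norm.
Qed.

(** Each norm is a single term of a nonnegative family with finite sum [S], so [S] itself bounds
    it. *)
Lemma mx_pseries2_coef_bound (R : realType) (m n : nat)
    (a : nat -> nat -> 'M[R]_(m, n)) (r : R) :
  0 < r -> mx_pseries2_abs_cvg a r r ->
  exists M, forall i j p q, `|a i j p q| <= M * r^-1 ^+ (i + j).
Proof.
move=> r0 h; set S := (\esum_(ij in [set: nat * nat])
  `| `|(r ^+ ij.1 * r ^+ ij.2) *: a ij.1 ij.2|%:E|)%E in h *.
have hS : (S < +oo)%E by [].
have S0 : (0 <= S)%E by apply: esum_ge0.
exists (fine S) => i j p q.
rewrite exprVn ler_pdivlMr ?exprn_gt0 // mulrC.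
apply: (@le_trans _ _ (`|(r ^+ i * r ^+ j) *: a i j|)).
  rewrite -exprD normrZ normrX (gtr0_norm r0).
  by rewrite ler_pM2l ?exprn_gt0 // ler_entry_mx_norm.
rewrite -lee_fin fineK; last by rewrite ge0_fin_numE.
rewrite /S; apply: esum_ge; exists [set (i, j)].
  by split => //; exact: finite_set1.
by rewrite fsbig_set1 /= normr_id.
Qed.

Lemma pseries_taylor (R : realType) (a : nat -> R) (M c t : R) :
  0 <= c -> c * `|t| <= 2^-1 -> (forall i, `|a i| <= M * c ^+ i) ->
  cvgn (series (fun i => t ^+ i * a i)) /\
  forall n, `|limn (series (fun i => t ^+ i * a i)) - \sum_(i < n) t ^+ i * a i|
            <= 2 * M * (c * `|t|) ^+ n.
Proof.
move=> c0 ct ha.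
have [|i|cu hu] := @cvg_series_geometric_tail _ (fun i => t ^+ i * a i) M _ _ ct.
- exact: mulr_ge0.
- rewrite normrM normrX exprMn mulrA mulrC.
  by apply: ler_wpM2r; rewrite ?exprn_ge0.
- by split=> // n; have := hu n; rewrite /series /= big_mkord.
Qed.

Lemma mx_pseries_taylor (R : realType) (m n : nat) (a : nat -> 'M[R]_(m, n)) (M c t : R) :
  0 <= c -> c * `|t| <= 2^-1 -> (forall i p q, `|a i p q| <= M * c ^+ i) ->
  forall p q,
  (fun d => \sum_(i < d) t ^+ i * a i p q) @ \oo --> mx_pseries a t p q /\
  forall d, `|mx_pseries a t p q - \sum_(i < d) t ^+ i * a i p q|
            <= 2 * M * (c * `|t|) ^+ d.
Proof.
move=> c0 ct ha p q.
have E p' q' : (fun i => (t ^+ i *: a i) p' q') = (fun i => t ^+ i * a i p' q').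
  by apply/funext => i; rewrite mxE.
have C p' q' := @pseries_taylor _ (fun i => a i p' q') M c t c0 ct
  (fun i => ha i p' q').
have -> : mx_pseries a t p q = limn (series (fun i => t ^+ i * a i p q)).
  rewrite /mx_pseries limn_series_mx_entry ?E // => p' q'.
  by rewrite E; case: (C p' q').
have [h1 h2] := C p q; split=> //.
have -> : (fun d => \sum_(i < d) t ^+ i * a i p q) = series (fun i => t ^+ i * a i p q).
  by apply/funext => d; rewrite /series /= big_mkord.
exact: h1.
Qed.

(** * Double series: entries, truncation errors and measurability *)

Section double_series.
Variables (R : realType) (a : nat -> nat -> R) (M c t s : R).
Hypotheses (c0 : 0 <= c) (ct : c * `|t| <= 2^-1) (cs : c * `|s| <= 2^-1).
Hypothesis ha : forall i j, `|a i j| <= M * c ^+ (i + j).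

Let row i := limn (series (fun j => t ^+ i * s ^+ j * a i j)).

Lemma pseries2_row_taylor i :
  cvgn (series (fun j => t ^+ i * s ^+ j * a i j)) /\
  forall n, `|row i - \sum_(j < n) t ^+ i * s ^+ j * a i j|
            <= 2 * (M * (c * `|t|) ^+ i) * (c * `|s|) ^+ n.
Proof.
have [|j|cu hu] := @cvg_series_geometric_tail _ (fun j => t ^+ i * s ^+ j * a i j)
  (M * (c * `|t|) ^+ i) _ _ cs.
- exact: mulr_ge0.
- rewrite !normrM !normrX !exprMn.
  have -> : M * (c ^+ i * `|t| ^+ i) * (c ^+ j * `|s| ^+ j) =
     `|t| ^+ i * `|s| ^+ j * (M * c ^+ (i + j)) by rewrite exprD; ring.
  by apply: ler_wpM2l => //; rewrite mulr_ge0 ?exprn_ge0.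
- by split=> // n; have := hu n; rewrite /series /= big_mkord.
Qed.

(** The first error term comes from cutting the outer sum, whose rows decay like [(c * |t|) ^+ i];
    the second from cutting each of the [n] remaining rows at order [n]. *)
Lemma pseries2_taylor :
  cvgn (series row) /\
  forall n, `|limn (series row) - \sum_(i < n) \sum_(j < n) t ^+ i * s ^+ j * a i j|
            <= 4 * M * (c * `|t|) ^+ n + 2 * M * n%:R * (c * `|s|) ^+ n.
Proof.
have M0 : 0 <= M by have := ha 0%N 0%N; rewrite expr0 mulr1; apply: le_trans.
have q0 : 0 <= c * `|t| by exact: mulr_ge0.
have q1 : 0 <= c * `|s| by exact: mulr_ge0.
(* The row estimate at order 0 bounds the whole row, which supplies the geometric majorant with
   constant [2 * M]. *)
have [i|cu hu] := @cvg_series_geometric_tail _ row (2 * M) _ q0 ct.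
  have [_ /(_ 0%N)] := pseries2_row_taylor i.
  by rewrite big_ord0 subr0 expr0 mulr1 mulrA.
split=> // n.
have h2 : `|series row n - \sum_(i < n) \sum_(j < n) t ^+ i * s ^+ j * a i j|
    <= 2 * M * n%:R * (c * `|s|) ^+ n.
  rewrite /series /= big_mkord -sumrB; apply: le_trans (ler_norm_sum _ _ _) _.
  have -> : 2 * M * n%:R * (c * `|s|) ^+ n = \sum_(i < n) (2 * M * (c * `|s|) ^+ n).
    by rewrite sumr_const card_ord -mulr_natr; ring.
  apply: ler_sum => i _; have [_ /(_ n) h] := pseries2_row_taylor i.
  apply: le_trans h _; apply: ler_wpM2r; first exact: exprn_ge0.
  rewrite ler_wpM2l // ler_piMr // exprn_ile1 //.
  by apply: le_trans ct _; lra.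
have h1 := hu n.
have := ler_normD (limn (series row) - series row n)
  (series row n - \sum_(i < n) \sum_(j < n) t ^+ i * s ^+ j * a i j).
rewrite addrA subrK; lra.
Qed.

End double_series.

Section mx_double_series.
Variables (R : realType) (m n : nat) (a : nat -> nat -> 'M[R]_(m, n)) (M c : R).
Hypotheses (c0 : 0 <= c).
Hypothesis ha : forall i j p q, `|a i j p q| <= M * c ^+ (i + j).

Lemma mx_pseries2_entry (t s : R) p q : c * `|t| <= 2^-1 -> c * `|s| <= 2^-1 ->
  mx_pseries2 a t s p q =
  limn (series (fun i => limn (series (fun j => t ^+ i * s ^+ j * a i j p q)))).
Proof.
move=> ct cs.
have E i p' q' : (fun j => ((t ^+ i * s ^+ j) *: a i j) p' q') =
    (fun j => t ^+ i * s ^+ j * a i j p' q').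
  by apply/funext => j; rewrite mxE.
have row p' q' : (fun i => limn (series (fun j => (t ^+ i * s ^+ j) *: a i j)) p' q') =
    (fun i => limn (series (fun j => t ^+ i * s ^+ j * a i j p' q'))).
  apply/funext => i; rewrite limn_series_mx_entry ?E // => p1 q1; rewrite E.
  by case: (@pseries2_row_taylor _ (fun i j => a i j p1 q1) M c t s c0 cs
    (fun i j => ha i j p1 q1) i).
rewrite /mx_pseries2 limn_series_mx_entry ?row // => p1 q1; rewrite row.
by case: (@pseries2_taylor _ (fun i j => a i j p1 q1) M c t s c0 ct cs
    (fun i j => ha i j p1 q1)).
Qed.

(** Two nested pointwise limits: each row is a limit of polynomials in [s], and the entry is a limit
    of finite sums of rows. *)
Lemma measurable_fun_mx_pseries2 (t : R) p q : c * `|t| <= 2^-1 ->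
  measurable_fun `[0, t] (fun s => mx_pseries2 a t s p q).
Proof.
move=> ct.
have cs s : `[0, t]%classic s -> c * `|s| <= 2^-1.
  rewrite /= in_itv /= => /andP[s0 st]; apply: le_trans ct; apply: ler_wpM2l => //.
  by rewrite !ger0_norm // (le_trans s0).
pose f i j s := t ^+ i * s ^+ j * a i j p q.
apply: (@measurable_fun_cvg _ _ _ _ (fun d s =>
  \sum_(0 <= i < d) limn (series (fun j => f i j s)))).
  move=> d; apply: measurable_sum => i.
  apply: (@measurable_fun_cvg _ _ _ _ (fun d s => \sum_(0 <= j < d) f i j s)).
    move=> e; apply: measurable_sum => j.
    apply: measurable_funM => //; exact: measurable_funM.
  move=> s /cs h.
  by case: (@pseries2_row_taylor _ (fun i j => a i j p q) M c t s c0 h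
    (fun i j => ha i j p q) i).
move=> s /cs h; rewrite mx_pseries2_entry //.
by case: (@pseries2_taylor _ (fun i j => a i j p q) M c t s c0 ct h
    (fun i j => ha i j p q)).
Qed.

End mx_double_series.

Lemma measurable_fun_mx_pseries (R : realType) (m n : nat) (a : nat -> 'M[R]_(m, n))
    (M c t : R) p q :
  0 <= c -> c * `|t| <= 2^-1 -> (forall i p q, `|a i p q| <= M * c ^+ i) ->
  measurable_fun `[0, t] (fun s => mx_pseries a s p q).
Proof.
move=> c0 ct ha.
apply: (@measurable_fun_cvg _ _ _ _ (fun d (s : R) => \sum_(i < d) s ^+ i * a i p q)).
  move=> d; apply: measurable_sum => i.
  exact: measurable_funM.
move=> s; rewrite /= in_itv /= => /andP[s0 st].
have cs : c * `|s| <= 2^-1.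
  apply: le_trans ct; apply: ler_wpM2l => //.
  by rewrite !ger0_norm // (le_trans s0).
by case: (@mx_pseries_taylor _ _ _ a M c s c0 cs ha p q).
Qed.

(** * Error of a product, and summation along antidiagonals *)

Lemma prod_approx (R : realType) (f g P Q A B E F w : R) :
  `|f| <= A -> `|g| <= B -> `|f - P| <= E * w -> `|g - Q| <= F * w ->
  0 <= w -> w <= 1 -> 0 <= E ->
  `|f * g - P * Q| <= (E * B + (A + E) * F) * w.
Proof.
move=> fA gB fP gQ w0 w1 E0.
(* Since [w <= 1], the error of [P] is at most [E]; this controls [P] in the splitting
   [(f - P) * g + P * (g - Q)]. *)
have hP : `|P| <= A + E.
  have := ler_normB f (f - P); rewrite opprB addrC subrK.
  have : E * w <= E by rewrite ler_piMr.
  lra.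
have -> : f * g - P * Q = (f - P) * g + P * (g - Q) by ring.
apply: le_trans (ler_normD _ _) _; rewrite !normrM.
have -> : (E * B + (A + E) * F) * w = E * w * B + (A + E) * (F * w) by ring.
by apply: lerD; apply: ler_pM.
Qed.

(** The condition [m = i + j + l + 1] forces [l < m] and [i < m - l], and then leaves exactly one
    [j], namely [m - i - l - 1]. *)
Lemma big_ord_antidiagonal (V : nmodType) (m : nat) (g : nat -> nat -> nat -> V) :
  \sum_(i < m.+1) \sum_(j < m.+1) \sum_(l < m.+1)
    (if m == (i + (j + l).+1)%N then g i j l else 0) =
  \sum_(l < m) \sum_(i < m - l) g i (m - i - l - 1)%N l.
Proof.
under eq_bigr do rewrite exchange_big /=.
rewrite exchange_big /= big_ord_recr /= [X in _ + X]big1 ?addr0; last first.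
  by move=> i _; rewrite big1 // => j _; case: eqP => //; lia.
apply: eq_bigr => l _.
rewrite (big_ord_widen m.+1 (fun i => g i (m - i - l - 1)%N l)); last by lia.
rewrite [RHS]big_mkcond /=; apply: eq_bigr => i _.
case: ltnP => il; last by rewrite big1 // => j _; case: eqP => //; lia.
have h : (m - i - l - 1 < m.+1)%N by lia.
rewrite (bigD1 (Ordinal h)) //= ifT; last by apply/eqP; lia.
rewrite big1 ?addr0 // => j /eqP jn; case: eqP => // mE.
by exfalso; apply: jn; apply: val_inj => /=; lia.
Qed.

(** * The truncated Volterra equation and its residual polynomial *)

Section volterra_truncation.
Variables (R : realType) (N : nat) (K : nat -> nat -> 'M[R]_N) (X : nat -> 'cV[R]_N).
Variables (M c : R).
Hypotheses (c0 : 0 <= c).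
Hypothesis hK : forall i j p q, `|K i j p q| <= M * c ^+ (i + j).
Hypothesis hX : forall i p q, `|X i p q| <= M * c ^+ i.

(** The denominator comes from integrating [s ^+ (j + l)]. *)
Definition volterra_coef (p : 'I_N) i j l : R :=
  (\sum_q K i j p q * X l q ord0) / ((j + l).+1)%:R.

(* The integral over [s] in [0, u] of the degree-[n] truncation of the kernel at [t]
   times that of the solution, as a polynomial in [u]; it is evaluated at [u = t]. *)
Definition volterra_primitive (n : nat) (p : 'I_N) (t : R) : {poly R} :=
  \sum_(i < n) \sum_(j < n) \sum_(l < n)
    (t ^+ i * volterra_coef p i j l) *: 'X^((j + l).+1).

Lemma deriv_volterra_primitive n p t s :
  (volterra_primitive n p t)^`().[s] =
  \sum_q (\sum_(i < n) \sum_(j < n) t ^+ i * s ^+ j * K i j p q) *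
         (\sum_(l < n) s ^+ l * X l q ord0).
Proof.
under [RHS]eq_bigr do rewrite mulr_suml.
rewrite [RHS]exchange_big /= /volterra_primitive (raddf_sum (@deriv R)) horner_sum; apply: eq_bigr => i _.
under [RHS]eq_bigr do rewrite mulr_suml.
rewrite [RHS]exchange_big /= (raddf_sum (@deriv R)) horner_sum; apply: eq_bigr => j _.
under [RHS]eq_bigr do rewrite mulr_sumr.
rewrite [RHS]exchange_big /= (raddf_sum (@deriv R)) horner_sum; apply: eq_bigr => l _.
rewrite /= derivZ derivXn hornerZ hornerMn hornerXn /= -mulr_natr /volterra_coef.
rewrite -[RHS]/(\sum_q _).
under [RHS]eq_bigr => q _.
  have -> : t ^+ i * s ^+ j * K i j p q * (s ^+ l * X l q ord0) =
    t ^+ i * s ^+ (j + l) * (K i j p q * X l q ord0) by rewrite exprD; ring.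
  over.
rewrite -mulr_sumr.
have : (j + l).+1%:R != 0 :> R by rewrite pnatr_eq0.
by move: (_.+1%:R) => d d0; field.
Qed.

(** Each of the [N] products in an entry of the integrand is within [D * (c * t) ^+ n] of its
    truncation, uniformly for [s] in [[0, t]]; integrating contributes the last factor [t]. *)
Lemma volterra_integral_approx n p : exists C, forall t, 0 <= t -> c * t <= 2^-1 ->
  `|mx_integral 0 t (fun s => mx_pseries2 K t s *m mx_pseries X s) p ord0
    - (volterra_primitive n p t).[t]| <= C * (c * t) ^+ n * t.
Proof.
(* [E] is the truncation constant of the kernel once [s <= t] merges its two error terms. [D] is the
   constant of [prod_approx], with [4 * M] bounding the kernel entries and [2 * M] serving both as
   bound and as truncation constant for the solution. *)
pose E := 4 * M + 2 * M * n%:R.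
pose D := E * (2 * M) + (4 * M + E) * (2 * M).
have M0 : 0 <= M by have := hX 0%N p ord0; rewrite expr0 mulr1; apply: le_trans.
exists (N%:R * D) => t t0 ct.
have nt : `|t| = t by rewrite ger0_norm.
have ct' : c * `|t| <= 2^-1 by rewrite nt.
have F0 : (volterra_primitive n p t).[0] = 0.
  rewrite /volterra_primitive !horner_sum big1 // => i _; rewrite horner_sum big1 // => j _.
  by rewrite horner_sum big1 // => l _; rewrite hornerZ hornerXn expr0n mulr0.
rewrite /mx_integral mxE -[X in _ - X]subr0 -[X in _ - (_ - X)]F0.
under eq_Rintegral do rewrite mxE.
apply: Rintegral_deriv_poly_approx; first exact: t0.
  apply: measurable_sum => q; apply: measurable_funM.
    exact: (measurable_fun_mx_pseries2 _ _ _ _ _ _ c0 hK).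
  exact: (measurable_fun_mx_pseries _ _ _ _ _ _ _ _ _ c0 ct' hX).
move=> s s0 st.
have ns : `|s| = s by rewrite ger0_norm.
have cs : c * `|s| <= 2^-1.
  by apply: le_trans ct; rewrite ns; apply: ler_wpM2l.
have w0 : 0 <= (c * t) ^+ n by rewrite exprn_ge0 // mulr_ge0.
have w1 : (c * t) ^+ n <= 1.
  by apply: exprn_ile1; [exact: mulr_ge0 | apply: le_trans ct _; lra].
have ws : (c * s) ^+ n <= (c * t) ^+ n.
  by apply: lerXn2r; rewrite ?nnegrE ?mulr_ge0 // ler_wpM2l.
rewrite deriv_volterra_primitive -sumrB; apply: le_trans (ler_norm_sum _ _ _) _.
have -> : N%:R * D * (c * t) ^+ n = \sum_(q < N) D * (c * t) ^+ n.
  by rewrite sumr_const card_ord -mulr_natr; ring.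
apply: ler_sum => q _.
have [_ hk] := @pseries2_taylor _ (fun i j => K i j p q) M c t s c0 ct' cs
  (fun i j => hK i j p q).
have [_ hx] := @mx_pseries_taylor _ _ _ X M c s c0 cs hX q ord0.
rewrite (@mx_pseries2_entry _ _ _ K M c c0 hK) //.
apply: prod_approx => //.
(* Truncation at order 0 leaves the empty sum, so the remainder estimate bounds the series
   itself. *)
- by have := hk 0%N; rewrite big_ord0 subr0 !expr0; lra.
- by have := hx 0%N; rewrite big_ord0 subr0 !expr0; lra.
- apply: le_trans (hk n) _; rewrite nt ns /E (mulrDl (4 * M)) lerD2l.
  by apply: ler_wpM2l => //; rewrite !mulr_ge0 // ler0n.
- by apply: le_trans (hx n) _; rewrite ns; apply: ler_wpM2l => //; rewrite mulr_ge0.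
- by rewrite /E addr_ge0 // !mulr_ge0 // ler0n.
Qed.

Variable Xi : nat -> 'cV[R]_N.
Hypothesis hXi : forall i p q, `|Xi i p q| <= M * c ^+ i.

(** Here the first argument of the kernel and the upper limit of integration become one
    indeterminate, which gives the degree [i + (j + l).+1]. *)
Definition volterra_residue (n : nat) (p : 'I_N) : {poly R} :=
  \sum_(i < n) (X i p ord0 - Xi i p ord0) *: 'X^i -
  \sum_(i < n) \sum_(j < n) \sum_(l < n) volterra_coef p i j l *: 'X^(i + (j + l).+1).

Lemma volterra_residue_horner n p t : (volterra_residue n p).[t] =
  \sum_(i < n) t ^+ i * X i p ord0 - \sum_(i < n) t ^+ i * Xi i p ord0
  - (volterra_primitive n p t).[t].
Proof.
rewrite /volterra_residue hornerD hornerN -sumrB !horner_sum; congr (_ - _).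
  by apply: eq_bigr => i _; rewrite hornerZ hornerXn; ring.
apply: eq_bigr => i _; rewrite !horner_sum; apply: eq_bigr => j _.
rewrite !horner_sum; apply: eq_bigr => l _.
by rewrite !hornerZ !hornerXn exprD; ring.
Qed.

(** Order [m.+1] retains every index triple that contributes to degree [m], so this coefficient is
    not affected by the truncation. *)
Lemma volterra_residue_coef m p : (volterra_residue m.+1 p)`_m =
  X m p ord0 - Xi m p ord0 -
  \sum_(l < m) \sum_(i < m - l) volterra_coef p i (m - i - l - 1)%N l.
Proof.
rewrite /volterra_residue coefB; congr (_ - _).
  rewrite coef_sum big_ord_recr /= big1 ?add0r => [|i _]; rewrite coefZ coefXn.
    by rewrite eqxx mulr1.
  by rewrite gtn_eqF ?mulr0.
rewrite -(big_ord_antidiagonal _ _ (volterra_coef p)) coef_sum; apply: eq_bigr => i _.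
rewrite coef_sum; apply: eq_bigr => j _; rewrite coef_sum; apply: eq_bigr => l _.
by rewrite coefZ coefXn; case: eqP => _; rewrite ?mulr1 ?mulr0.
Qed.

(** The equation cancels the full series and the integral, so the residue at [t] consists of the
    three truncation errors, all of order [t ^+ m.+1]. *)
Lemma volterra_residue_eq0 (d : R) : 0 < d ->
  (forall t, 0 < t -> t < d -> mx_pseries X t = mx_pseries Xi t +
     mx_integral 0 t (fun s => mx_pseries2 K t s *m mx_pseries X s)) ->
  (forall t, 0 < t -> t < d -> c * t <= 2^-1) ->
  forall m p, (volterra_residue m.+1 p)`_m = 0.
Proof.
move=> d0 volt cd m p.
have [C hC] := volterra_integral_approx m.+1 p.
(* The series of [X] and [Xi] contribute [2 * M] each; the integral contributes [|C| * d], as its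
   extra factor [t] is below [d]. *)
apply: (@poly_coef_eq0_near0 _ m.+1 _ ((4 * M + `|C| * d) * c ^+ m.+1) d) => // t t0 td.
have t0' := ltW t0; have ct := cd t t0 td.
have nt : `|t| = t by rewrite ger0_norm.
have ct' : c * `|t| <= 2^-1 by rewrite nt.
have [_ /(_ m.+1) h1] := @mx_pseries_taylor _ _ _ X M c t c0 ct' hX p ord0.
have [_ /(_ m.+1) h2] := @mx_pseries_taylor _ _ _ Xi M c t c0 ct' hXi p ord0.
have h3 := hC t t0' ct.
have w0 : 0 <= (c * t) ^+ m.+1 by rewrite exprn_ge0 // mulr_ge0.
have h4 : C * (c * t) ^+ m.+1 * t <= `|C| * d * (c * t) ^+ m.+1.
  rewrite -mulrA [_ * t]mulrC mulrA; apply: ler_wpM2r => //.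
  by apply: le_trans (ler_norm _) _; rewrite normrM nt ler_wpM2l // ltW.
have e := congr1 (fun A : 'cV[R]_N => A p ord0) (volt t t0 td).
rewrite /= mxE in e.
rewrite nt in h1 h2.
rewrite volterra_residue_horner -mulrA -exprMn.
move: h1 h2 h3 h4; rewrite !ler_norml e; lra.
Qed.

End volterra_truncation.

(** * From absolute convergence and the equation near 0 to the recursion *)

Theorem mainTheorem6 (R : realType) (N : nat)
    (K : nat -> nat -> 'M[R]_N) (Xi X : nat -> 'cV[R]_N)
    (k : R -> R -> 'M[R]_N) (xi x : R -> 'cV[R]_N) (rho : R)
    (rho_gt0 : 0 < rho)
    (k_cvg : forall t s : R, `|t| < rho -> `|s| < rho ->
       mx_pseries2_abs_cvg K t s)
    (kE : forall t s : R, `|t| < rho -> `|s| < rho -> k t s = mx_pseries2 K t s)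
    (xi_cvg : forall t : R, `|t| < rho -> mx_pseries_abs_cvg Xi t)
    (xiE : forall t : R, `|t| < rho -> xi t = mx_pseries Xi t)
    (x_cvg : forall t : R, `|t| < rho -> mx_pseries_abs_cvg X t)
    (xE : forall t : R, `|t| < rho -> x t = mx_pseries X t)
    (volterra : \forall t \near (0 : R), 0 <= t ->
       x t = xi t + mx_integral 0 t (fun s => k t s *m x s)) :
  forall n : nat,
    X n = Xi n + \sum_(l < n) \sum_(i < n - l)
      ((n - i)%N%:R)^-1 *: (K i (n - i - l - 1)%N *m X l).
Proof.
(* With [j = n - i - l - 1] the denominator [j + l + 1] becomes [n - i]; the range of [i] keeps the
   natural subtractions from being cut off at 0. *)
have idx a b e : (a < e - b)%N -> ((e - a - b - 1 + b).+1 = e - a)%N by lia.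
pose r := rho / 2.
have r0 : 0 < r by rewrite divr_gt0.
have rr : `|r| < rho by rewrite gtr0_norm // /r; lra.
have [M1 hM1] := mx_pseries2_coef_bound _ _ _ _ _ r0 (k_cvg r r rr rr).
have [M2 hM2] := mx_pseries_coef_bound _ _ _ _ _ r0 (x_cvg r rr).
have [M3 hM3] := mx_pseries_coef_bound _ _ _ _ _ r0 (xi_cvg r rr).
(* One [M] majorizes the constants of all three series; absolute values are summed since no sign of
   the [Mi] is at hand. *)
pose c := r^-1; pose M : R := `|M1| + `|M2| + `|M3|.
have c0 : 0 <= c by rewrite invr_ge0 ltW.
have hM (m a : R) e : `|a| <= m * c ^+ e -> m <= M -> `|a| <= M * c ^+ e.
  by move=> h /ler_wpM2r h'; apply: le_trans h (h' _ _); exact: exprn_ge0.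
have n1 := ler_norm M1; have n2 := ler_norm M2; have n3 := ler_norm M3.
have p1 := normr_ge0 M1; have p2 := normr_ge0 M2; have p3 := normr_ge0 M3.
have [m1 m2 m3] : [/\ M1 <= M, M2 <= M & M3 <= M] by rewrite /M; split; lra.
have hK i j p q := hM _ _ _ (hM1 i j p q) m1.
have hX i p q := hM _ _ _ (hM2 i p q) m2.
have hXi i p q := hM _ _ _ (hM3 i p q) m3.
have /nbhs_ballP[e /= e0 he] := volterra.
(* Below [e] the equation holds; below [r / 2] one has [c * t <= 1/2] and [t < rho]. *)
pose d := Num.min e (r / 2).
have d0 : 0 < d by rewrite lt_min e0 divr_gt0.
have rE : c * r = 1 by rewrite /c mulVf // gt_eqF.
have volt t : 0 < t -> t < d -> mx_pseries X t = mx_pseries Xi t +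
     mx_integral 0 t (fun s => mx_pseries2 K t s *m mx_pseries X s).
  move=> t0; rewrite lt_min => /andP[te tr].
  have trho : `|t| < rho by rewrite gtr0_norm //; apply: lt_trans tr _; rewrite /r; lra.
  rewrite -xE // -xiE // he; [|by rewrite /ball /= sub0r normrN gtr0_norm|exact: ltW].
  (* The integrands need to agree on [[0, t]] only, where [|s| <= t < rho] lets both series replace
     [k] and [x]. *)
  congr (_ + _); apply/matrixP => p q; rewrite !mxE; apply: eq_Rintegral => s.
  rewrite inE /= in_itv /= => /andP[s0 st].
  have srho : `|s| < rho.
    by apply: le_lt_trans trho; rewrite ger0_norm // (le_trans st) // ler_norm.
  by rewrite kE // xE.
have cd t : 0 < t -> t < d -> c * t <= 2^-1.
  move=> _; rewrite lt_min => /andP[_ /ltW tr].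
  by apply: le_trans (ler_wpM2l c0 tr) _; rewrite mulrA rE mul1r.
move=> n; apply/matrixP => p q; rewrite (ord1 q) {q}.
have := volterra_residue_eq0 _ _ _ _ _ _ c0 hK hX _ hXi _ d0 volt cd n p.
rewrite volterra_residue_coef => /eqP; rewrite subr_eq0 => /eqP h.
rewrite mxE -[LHS](subrK (Xi n p ord0)) h addrC; congr (_ + _).
rewrite summxE; apply: eq_bigr => l _; rewrite summxE; apply: eq_bigr => i _.
rewrite !mxE mulrC /volterra_coef; by rewrite idx.
Qed.
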